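(* Let $\mathcal{X}=\mathbb{T}^d$, consider the diffusion $dX_t=b(X_t)\,dt+dW_t$ with $b\in C^\infty(\mathbb{T}^d)$, let $f\in C^\infty(\mathbb{T}^d)$, and let $Q^f_{\Delta t}$ be a consistent discretization of the associated Feynman–Kac semigroup satisfying Assumption 6. Then there exists $\Delta t^{**}>0$ such that for every $\Delta t\in(0,\Delta t^{**}]$ the discrete Feynman–Kac dynamics $\Phi_k(\mu)(\varphi)=\mu((Q^f_{\Delta t})^k\varphi)/\mu((Q^f_{\Delta t})^k\mathbb{1})$ admits a unique invariant probability measure $\mu^*_{f,\Delta t}$ (fixed point of $\Phi_1$), and there exist $\kappa>0$, $C>0$ (independent of $\Delta t$) such that for every bounded measurable $\varphi$, every probability measure $\mu$ on $\mathbb{T}^d$ and every $\Delta t\in(0,\Delta t^{**}]$, $$\forall\,k\geq0,\quad \big|\Phi_k(\mu)(\varphi)-\mu^*_{f,\Delta t}(\varphi)\big|\leq Ce^{-\kappa k\Delta t}\|\varphi\|_{L^\infty}.$$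
   Context: Generator $\mathcal{L}=b\cdot\nabla+\frac12\Delta$. $\lceil a\rceil$ is the upper integer part; $\mathbb{1}$ is the constant function $1$; $\Phi_0(\mu)=\mu$. Consistent discretization: a kernel operator $Q^f_{\Delta t}$ (depending on a time step $\Delta t>0$) such that for every bounded measurable $\varphi$, $Q^f_{\Delta t}\varphi$ is continuous (strong Feller), and there exist $\Delta t^*>0$, $C>0$, $p\in\mathbb{N}$ and operators $\mathcal{R}_{\Delta t}:C^\infty(\mathbb{T}^d)\to C^\infty(\mathbb{T}^d)$ such that for all $\varphi\in C^\infty$, $Q^f_{\Delta t}\varphi=\varphi+\Delta t(\mathcal{L}+f)\varphi+\Delta t^2\mathcal{R}_{\Delta t}\varphi$ with $\|\mathcal{R}_{\Delta t}\varphi\|_{L^\infty}\leq C\sup_{|m|\leq p}\|\partial^m\varphi\|_{L^\infty}$ for all $\Delta t\in(0,\Delta t^*]$. Assumption 6 (uniform minorization and boundedness): for a fixed $T>0$ there exist $\Delta t^*>0$, a probability measure $\eta$ on $\mathbb{T}^d$ and $\alpha\in(0,1)$ such that for every $\Delta t\in(0,\Delta t^*]$, $Q^f_{\Delta t}$ is strong Feller and for every bounded measurable $\varphi\geq0$ and all $x$: $\alpha\eta(\varphi)\leq\big((Q^f_{\Delta t})^{\lceil T/\Delta t\rceil}\varphi\big)(x)\leq\alpha^{-1}\eta(\varphi)$. *)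

(* Defs.v *)
From HB Require Import structures.
From mathcomp Require Import all_boot all_order all_algebra.
From mathcomp Require Import all_classical all_reals all_analysis.
Set Implicit Arguments. Unset Strict Implicit. Unset Printing Implicit Defensive.
Import Order.TTheory GRing.Theory Num.Theory.
Import numFieldNormedType.Exports.
Local Open Scope classical_set_scope.
Local Open Scope ring_scope.

(* The torus T^d is represented by R^d = 'rV[R]_d, with functions on T^d being
   1-periodic functions on R^d (in each coordinate direction), and probability
   measures on T^d represented by (Borel) probability measures on R^d, acting on
   periodic functions (every probability measure on T^d arises this way, e.g.
   from a measure carried by [0,1)^d). *)

Section Torus.
Variables (R : realType) (d : nat).

Definition V := 'rV[R]_d.
Definition Tor := g_sigma_algebraType (@open V).

Definition evec (i : 'I_d) : V := delta_mx 0 i.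

Definition periodic (phi : V -> R) := forall x i, phi (x + evec i) = phi x.

Definition pd (i : 'I_d) (phi : V -> R) : V -> R := fun x => 'D_(evec i) phi x.
Definition dpart (s : seq 'I_d) (phi : V -> R) : V -> R := foldr pd phi s.

Definition smooth (phi : V -> R) := forall s : seq 'I_d,
  continuous (dpart s phi) /\
  forall (i : 'I_d) (x : V), derivable (dpart s phi) x (evec i).
Definition smooth_torus (phi : V -> R) := smooth phi /\ periodic phi.

Definition supnorm (phi : V -> R) : R := sup [set `|phi x| | x in [set: V]].

Definition supnorm_upto (p : nat) (phi : V -> R) : R :=
  sup [set supnorm (dpart s phi) | s in [set s : seq 'I_d | (size s <= p)%N]].

Definition bmeas (phi : V -> R) := periodic phi /\
  measurable_fun [set: Tor] (phi : Tor -> R) /\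
  exists M : R, forall x, `|phi x| <= M.

Definition integ (mu : {measure set Tor -> \bar R}) (phi : V -> R) : R :=
  fine (\int[mu]_(y in [set: Tor]) (phi y)%:E)%E.

Definition gen (b : V -> V) (phi : V -> R) : V -> R := fun x =>
  \sum_(i < d) b x 0 i * pd i phi x + 2^-1 * \sum_(i < d) pd i (pd i phi) x.

Definition Qop (Q : R.-ftker Tor ~> Tor) (phi : V -> R) : V -> R :=
  fun x => integ (Q x) phi.
Definition Qpow (Q : R.-ftker Tor ~> Tor) (k : nat) (phi : V -> R) : V -> R :=
  iter k (Qop Q) phi.

Definition torus_kernel (Q : R.-ftker Tor ~> Tor) :=
  forall phi, bmeas phi -> periodic (Qop Q phi).

Definition strong_feller (Q : R.-ftker Tor ~> Tor) :=
  forall phi, bmeas phi -> continuous (Qop Q phi).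

Definition consistent (b : V -> V) (f : V -> R) (Q : R -> R.-ftker Tor ~> Tor) :=
  (forall dt, 0 < dt -> strong_feller (Q dt)) /\
  exists (dts C : R) (p : nat) (Rop : R -> (V -> R) -> (V -> R)),
    0 < dts /\ 0 < C /\
    forall dt, 0 < dt -> dt <= dts ->
    forall phi, smooth_torus phi ->
      smooth_torus (Rop dt phi) /\
      (forall x, Qop (Q dt) phi x =
         phi x + dt * (gen b phi x + f x * phi x) + dt ^+ 2 * Rop dt phi x) /\
      supnorm (Rop dt phi) <= C * supnorm_upto p phi.

Definition assumption6 (T : R) (Q : R -> R.-ftker Tor ~> Tor) :=
  exists (dts : R) (eta : probability Tor R) (alpha : R),
    0 < dts /\ 0 < alpha < 1 /\
    forall dt, 0 < dt -> dt <= dts ->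
      strong_feller (Q dt) /\
      forall phi, bmeas phi -> (forall x, 0 <= phi x) ->
      forall x,
        alpha * integ eta phi <= Qpow (Q dt) `|Num.ceil (T / dt)|%N phi x /\
        Qpow (Q dt) `|Num.ceil (T / dt)|%N phi x <= alpha^-1 * integ eta phi.

Definition Phi (Q : R.-ftker Tor ~> Tor) (k : nat)
    (mu : {measure set Tor -> \bar R}) (phi : V -> R) : R :=
  integ mu (Qpow Q k phi) / integ mu (Qpow Q k (fun _ => 1)).

Definition fk_invariant (Q : R.-ftker Tor ~> Tor) (mu : probability Tor R) :=
  forall phi, bmeas phi -> Phi Q 1 mu phi = integ mu phi.

End Torus.

(* Main.v *)
Require Import Defs.
From HB Require Import structures.
From mathcomp Require Import all_boot all_order all_algebra.
From mathcomp Require Import all_classical all_reals all_analysis.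
From mathcomp Require Import measurable_realfun lra ring.
Import Order.TTheory GRing.Theory Num.Theory.
Import numFieldNormedType.Exports.
Local Open Scope classical_set_scope.
Local Open Scope ring_scope.

(** Write Q for Q^f_dt and N := ceil (T / dt). If m Q^k 1 <= Q^k phi <= M Q^k 1
    pointwise, positivity of Q propagates the same bounds to all later powers,
    and the two-sided minorization of Q^N shrinks the interval [m, M] by the
    factor 1 - alpha^2 when k becomes k + N. Since Phi_k(mu)(phi) lies in [m, M]
    whatever mu is, these nested intervals give a limit functional, the same for
    all initial measures, and a geometric rate in k / N, which N dt <= T + dt^*
    turns into an exponential rate in k dt uniform in dt. The limit functional
    is additive, monotone and dominated by alpha^-2 eta, so it is the integral
    against a probability measure, and this measure is invariant. *)

(** * Bounded measurable periodic functions and their integrals *)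

Section BoundedPeriodicFunctions.
Context {R : realType} {d : nat}.
Implicit Types (phi psi : V R d -> R) (mu : {measure set (Tor R d) -> \bar R}).

Lemma continuous_measurable_Tor phi :
  continuous phi -> measurable_fun [set: Tor R d] (phi : Tor R d -> R).
Proof.
move=> /continuousP cphi; apply: (measurability _ (RGenOpens.measurableE R)).
move=> _ [_ [a [b ->]] <-]; rewrite setTI.
apply: sub_sigma_algebra; apply: cphi; exact: interval_open.
Qed.

Lemma bmeas_cst (c : R) : bmeas (d := d) (fun=> c).
Proof.
split; first by [].
by split; [exact: measurable_cst | exists `|c|].
Qed.

Lemma bmeasD {phi psi} :
  bmeas phi -> bmeas psi -> bmeas (fun x => phi x + psi x).
Proof.
move=> [pphi [mphi [A hA]]] [ppsi [mpsi [B hB]]]; split.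
  by move=> x i; rewrite pphi ppsi.
split; first exact: measurable_funD.
by exists (A + B) => x; rewrite (le_trans (ler_normD _ _))// lerD.
Qed.

Lemma bmeasZ c {phi} : bmeas phi -> bmeas (fun x => c * phi x).
Proof.
move=> [pphi [mphi [A hA]]]; split; first by move=> x i; rewrite pphi.
split; first by apply: measurable_funM => //; exact: measurable_cst.
by exists (`|c| * A) => x; rewrite normrM ler_wpM2l.
Qed.

Lemma bmeasB {phi psi} :
  bmeas phi -> bmeas psi -> bmeas (fun x => phi x - psi x).
Proof.
move=> bphi bpsi.
rewrite (_ : (fun _ => _) = fun x => phi x + -1 * psi x).
  exact/bmeasD/bmeasZ.
by apply/funext => x; rewrite mulN1r.
Qed.

Lemma bmeas_sum n (F : nat -> V R d -> R) : (forall i, bmeas (F i)) ->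
  bmeas (fun x => \sum_(i < n) F i x).
Proof.
move=> bF; elim: n => [|n IH].
  rewrite (_ : (fun _ => _) = fun=> 0); first exact: bmeas_cst.
  by apply/funext => x; rewrite big_ord0.
rewrite (_ : (fun _ => _) = fun x => \sum_(i < n) F i x + F n x).
  exact: bmeasD.
by apply/funext => x; rewrite big_ord_recr.
Qed.

Lemma bmeas_le_supnorm phi x : bmeas phi -> `|phi x| <= supnorm phi.
Proof.
move=> [_ [_ [M hM]]]; apply: ub_le_sup; last by exists x.
by exists M => _ [y _ <-].
Qed.

Lemma bmeas_integrable mu phi : (mu setT < +oo)%E -> bmeas phi ->
  mu.-integrable setT (EFin \o (phi : Tor R d -> R)).
Proof.
move=> muT [_ [mphi [M hM]]]; apply: measurable_bounded_integrable => //.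
by exists M; split; [exact: num_real|move=> N MN x _; exact: le_trans (hM x) (ltW MN)].
Qed.

Lemma integD mu phi psi : (mu setT < +oo)%E -> bmeas phi -> bmeas psi ->
  integ mu (fun x => phi x + psi x) = integ mu phi + integ mu psi.
Proof. by move=> muT bphi bpsi; apply: RintegralD => //; exact: bmeas_integrable. Qed.

Lemma integZ mu c phi : (mu setT < +oo)%E -> bmeas phi ->
  integ mu (fun x => c * phi x) = c * integ mu phi.
Proof. by move=> muT bphi; apply: RintegralZl => //; exact: bmeas_integrable. Qed.

Lemma integ_le mu phi psi : (mu setT < +oo)%E -> bmeas phi -> bmeas psi ->
  (forall x, phi x <= psi x) -> integ mu phi <= integ mu psi.
Proof. by move=> muT bphi bpsi le; apply: le_Rintegral => //; exact: bmeas_integrable. Qed.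

Lemma integ_cst (mu : probability (Tor R d) R) c : integ mu (fun=> c) = c.
Proof.
apply: etrans (Rintegral_cst mu measurableT c) _.
by rewrite [X in fine X](probability_setT mu) mulr1.
Qed.

Lemma probability_lty (mu : probability (Tor R d) R) : (mu setT < +oo)%E.
Proof. by rewrite [X in (X < _)%E](probability_setT mu) ltry. Qed.

(** * Reduction to the fundamental cell [0,1)^d *)

Definition floorv (x : V R d) : V R d := \row_i (Num.floor (x 0 i))%:~R.
(** Representative modulo Z^d in [0,1)^d. Measures live on R^d but are tested on periodic functions
    only, so sets are compared through their trace on this cell. *)
Definition fract (x : V R d) : V R d := x - floorv x.

Lemma fractDevec x i : fract (x + evec R i) = fract x.
Proof.
apply/rowP => j; rewrite !mxE/= floorDrz; last by rewrite ?intr_nat ?rpred_nat.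
rewrite intrD; case: (j == i) => /=; last by rewrite floor0; lra.
by rewrite floor1; lra.
Qed.

Lemma periodicDn phi x i n : Defs.periodic phi -> phi (x + evec R i *+ n) = phi x.
Proof.
move=> pphi; elim: n => [|n IH]; first by rewrite mulr0n addr0.
by rewrite mulrSr addrA pphi.
Qed.

Lemma periodicDz phi x i (z : int) : Defs.periodic phi ->
  phi (x + z%:~R *: evec R i) = phi x.
Proof.
move=> pphi; case: z => n.
  by rewrite -pmulrn scaler_nat periodicDn.
rewrite NegzE mulrNz scaleNr -pmulrn scaler_nat.
by rewrite -[in RHS](subrK (evec R i *+ n.+1) x) periodicDn.
Qed.

Lemma periodic_fract phi x : Defs.periodic phi -> phi (fract x) = phi x.
Proof.
move=> pphi.
(* Integer translations along the coordinates in [r] are removed one at a time; taking all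
   coordinates removes [floorv x]. *)
have step (r : seq 'I_d) y :
    phi (y + \sum_(i <- r) (- Num.floor (x 0 i))%:~R *: evec R i) = phi y.
  elim: r y => [|i r IH] y; first by rewrite big_nil addr0.
  by rewrite big_cons addrA IH periodicDz.
rewrite -[RHS](step (index_enum 'I_d)); congr (phi (x + _)).
apply/rowP => j; rewrite !mxE summxE (bigD1 j)//= big1 => [|i ij].
  by rewrite !mxE/= !eqxx mulr1 mulrNz addr0.
by rewrite !mxE eqxx/= eq_sym (negbTE ij) mulr0.
Qed.

(** R^d is the countable union over integer vectors z of the cells where the floor is z, and on each
    cell [fract] is the continuous translation by -z. *)
Lemma measurable_fract : measurable_fun [set: Tor R d] (fract : Tor R d -> Tor R d).
Proof.
move=> _ A mA; rewrite setTI.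
have -> : fract @^-1` A = \bigcup_(z : 'rV[int]_d)
   ((\bigcap_(i in [set: 'I_d]) [set x : Tor R d | Num.floor (x 0 i) = z 0 i]) `&`
    ((fun x : Tor R d => (x : V R d) - map_mx intr z) @^-1` A)).
  apply/seteqP; split => [x Ax|x [z _ [zx Ax]]] /=.
    exists (map_mx Num.floor x) => //; split => [i _|] /=; first by rewrite mxE.
    by rewrite (_ : map_mx _ _ = floorv x)//; apply/rowP => i; rewrite !mxE.
  rewrite /fract (_ : floorv x = map_mx intr z)//.
  by apply/rowP => i; rewrite !mxE (zx i).
apply: countable_bigcupT_measurable => [|z]; first exact: countableP.
apply: measurableI.
  apply: fin_bigcap_measurable => // i _.
  have mc : measurable_fun [set: Tor R d] (fun x : Tor R d => (x : V R d) 0 i : R).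
    by apply: continuous_measurable_Tor; exact: coord_continuous.
  have := mc measurableT _ (@measurable_itv R `[(z 0 i)%:~R, (z 0 i + 1)%:~R[).
  rewrite setTI; congr measurable; apply/seteqP; split => x /=.
    by rewrite in_itv/= => h; apply: floor_def.
  by rewrite in_itv/= => <-; exact: floor_itv.
have mt : measurable_fun [set: Tor R d]
    ((fun x : Tor R d => (x : V R d) - map_mx intr z) : Tor R d -> Tor R d).
  apply: (@measurability _ _ (Tor R d) (Tor R d) setT _ (@open (V R d)) erefl).
  move=> _ [U oU <-]; rewrite setTI.
  apply: sub_sigma_algebra.
  have /continuousP : continuous (fun x : V R d => x - map_mx intr z : V R d).
    move=> x; apply: (@continuousB R ('rV[R]_d : normedModType R) _ id
      (cst (map_mx intr z)) x); [exact: cvg_id|exact: cst_continuous].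
  by apply.
by have := mt measurableT _ mA; rewrite setTI.
Qed.

(** By periodicity all values are already taken on the compact cube [0,1]^d. *)
Lemma periodic_continuous_bounded phi : Defs.periodic phi -> continuous phi ->
  exists M, forall x, `|phi x| <= M.
Proof.
move=> pphi cphi.
have cptK : compact [set v : V R d | forall i, `[0, 1]%classic (v ord0 i)].
  exact: (@rV_compact R d (fun=> `[0, 1]%classic) (fun=> @segment_compact R 0 1)).
have := continuous_compact (continuous_subspaceT cphi) cptK.
move=> /compact_bounded[M [_ hM]].
exists (M + 1) => x; rewrite -periodic_fract//; apply: (hM (M + 1)); first lra.
exists (fract x) => //= i; rewrite in_itv/= !mxE.
by have := floor_itv (x ord0 i); rewrite intrD => ?; lra.
Qed.

(* The indicator of the periodic extension of the trace of A on [0, 1)^d. *)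
Definition perindic (A : set (Tor R d)) : V R d -> R := fun x => \1_A (fract x).

Lemma bmeas_perindic A : measurable A -> bmeas (perindic A).
Proof.
move=> mA; split; first by move=> x i; rewrite /perindic fractDevec.
split.
  have h := @measurable_indic _ (Tor R d) R setT A mA.
  by have := measurableT_comp h measurable_fract.
by exists 1 => x; rewrite /perindic indicE normr_nat; case: (_ \in _).
Qed.

Lemma integ_perindic mu A : measurable A ->
  integ mu (perindic A) = fine (mu (fract @^-1` A)).
Proof.
move=> mA; rewrite /integ.
have mB : measurable (fract @^-1` A : set (Tor R d)).
  by have := measurable_fract measurableT _ mA; rewrite setTI.
rewrite -[X in _ = fine (mu X)]setIT -integral_indic//.
Qed.

End BoundedPeriodicFunctions.

(** * Representation of dominated positive functionals by probability measures *)

Section PositiveFunctionals.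
Context {R : realType} {d : nat}.
Implicit Types (F G : (V R d -> R) -> R) (phi psi : V R d -> R).

Definition bmeas_additive F := forall phi psi, bmeas phi -> bmeas psi ->
  F (fun x => phi x + psi x) = F phi + F psi.

Definition bmeas_monotone F := forall phi psi, bmeas phi -> bmeas psi ->
  (forall x, phi x <= psi x) -> F phi <= F psi.

Lemma bmeas_additive_sum F n (f : nat -> V R d -> R) : bmeas_additive F ->
  (forall i, bmeas (f i)) ->
  F (fun x => \sum_(i < n) f i x) = \sum_(i < n) F (f i).
Proof.
move=> addF bf; elim: n => [|n IH].
  rewrite big_ord0 (_ : (fun _ => _) = fun=> 0).
    (* The empty sum needs F 0 = 0, which follows from F 0 + F 0 = F 0. *)
    apply: (@addrI _ (F (fun=> 0))); rewrite -addF; try exact: bmeas_cst.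
    by rewrite [RHS]addr0; congr (F _); apply/funext => x; rewrite addr0.
  by apply/funext => x; rewrite big_ord0.
rewrite big_ord_recr/= -IH -addF//; last exact: bmeas_sum.
by congr (F _); apply/funext => x; rewrite big_ord_recr.
Qed.

(** The sum counts the naturals below y, so it is the ceiling of y. *)
Lemma sum_ltr_nat_bounds (y : R) K : 0 <= y <= K%:R ->
  y <= \sum_(j < K) (j%:R < y)%R%:R <= y + 1.
Proof.
move=> /andP[y0]; elim: K => [|K IH] yK; rewrite ?big_ord0 ?big_ord_recr/=.
  by apply/andP; split; lra.
have [yK'|Ky] := leP y K%:R.
  by rewrite addr0 IH.
have -> : \sum_(j < K) (j%:R < y)%R%:R = K%:R :> R.
  rewrite (eq_bigr (fun=> 1)) ?sumr_const ?card_ord// => j _.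
  by rewrite (le_lt_trans _ Ky)// ler_nat ltnW.
by rewrite -natr1 in yK; rewrite /=; apply/andP; split; lra.
Qed.

(* n phi is within 1 of the sum over j < n M of the indicators of [n phi > j],
   when 0 <= phi <= M. *)
Lemma eq_positive_functional F G :
  bmeas_additive F -> bmeas_additive G -> bmeas_monotone F -> bmeas_monotone G ->
  (forall c, F (fun=> c) = G (fun=> c)) ->
  (forall A, measurable A -> F (perindic A) = G (perindic A)) ->
  forall phi, bmeas phi -> F phi = G phi.
Proof.
move=> addF addG monF monG eqc eqA.
suff pos phi (M : nat) : bmeas phi -> (forall x, 0 <= phi x <= M%:R) -> F phi = G phi.
  move=> phi bphi; have [_ [_ [B hB]]] := bphi.
  have B0 : 0 <= B by exact: le_trans (normr_ge0 _) (hB 0).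
  have bB := @bmeas_cst R d B.
  (* Adding the constant B, on which F and G agree, moves the values of phi into [0, 2B]. *)
  apply: (@addIr _ (F (fun=> B))); rewrite [in RHS]eqc -addF// -addG//.
  apply: (pos _ (Num.truncn (2 * B)).+1); first exact: bmeasD.
  move=> x; have := hB x; rewrite ler_norml => /andP[h1 h2].
  have := truncnS_gt (2 * B); by move=> h3; apply/andP; split; lra.
move=> bphi hphi.
pose A n j : set (Tor R d) := [set x | j%:R < n%:R * phi x].
have mA n j : measurable (A n j).
  have [_ [m _]] := bmeasZ n%:R bphi.
  have := m measurableT _ (@measurable_itv R `]j%:R, +oo[).
  by rewrite setTI; congr measurable; apply/seteqP; split => x /=; rewrite in_itv/= andbT.
have indE n j x : perindic (A n j) x = (j%:R < n%:R * phi x)%R%:R.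
  rewrite /perindic indicE; congr (_%:R); rewrite -(periodic_fract phi x bphi.1).
  by apply: congr1; apply/idP/idP; rewrite inE.
have key H n : bmeas_additive H -> bmeas_monotone H ->
    n%:R * H phi <= \sum_(j < n * M) H (perindic (A n j)) <= n%:R * H phi + H (fun=> 1).
  move=> addH monH.
  (* Homogeneity is not assumed: n phi is treated as a sum of n copies of phi. *)
  have -> : n%:R * H phi = H (fun x => n%:R * phi x).
    rewrite mulr_natl -[X in _ *+ X]card_ord -sumr_const.
    rewrite -(bmeas_additive_sum _ _ (fun=> phi))//; congr (H _); apply/funext => x.
    by rewrite sumr_const card_ord mulr_natl.
  have bs : bmeas (fun x => \sum_(j < n * M) perindic (A n j) x).
    by apply: (bmeas_sum _ (fun j => perindic (A n j))) => j; exact: bmeas_perindic.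
  have bn := bmeasZ n%:R bphi.
  have b1 := @bmeas_cst R d 1.
  rewrite -addH// -(bmeas_additive_sum _ _ (fun j => perindic (A n j)))//; last first.
    by move=> j; exact: bmeas_perindic.
  have h x : n%:R * phi x <= \sum_(j < n * M) perindic (A n j) x <= n%:R * phi x + 1.
    rewrite (eq_bigr (fun j : 'I_(n * M) => (j%:R < n%:R * phi x)%R%:R))
      => [|j _]; last exact: indE.
    apply: sum_ltr_nat_bounds.
    by have /andP[h0 h1] := hphi x; rewrite natrM mulr_ge0// ler_wpM2l.
  apply/andP; split; apply: monH => //; first by move=> x; have /andP[] := h x.
    exact: bmeasD.
  by move=> x; have /andP[] := h x.
apply/eqP; rewrite -subr_eq0 -normr_le0; apply/ler_addgt0Pl => e e0; rewrite addr0.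
pose c := `|F (fun=> 1)|.
have hc : F (fun=> 1) <= c by exact: ler_norm.
(* Both n F phi and n G phi lie within F 1 = G 1 of one common sum, so n |F phi - G phi| <= c; this
   n makes c / n smaller than e. *)
pose n := (Num.truncn (c / e)).+1.
have hn : c < n%:R * e by rewrite -ltr_pdivrMr// truncnS_gt.
have n0 : 0 < n%:R :> R by rewrite ltr0n.
have /andP[F1 F2] := key F n addF monF.
have /andP[G1 G2] := key G n addG monG.
have eqS : \sum_(j < n * M) F (perindic (A n j)) = \sum_(j < n * M) G (perindic (A n j)).
  by apply: eq_bigr => j _; exact: eqA.
rewrite -eqS -eqc in G1 G2.
rewrite -(ler_pM2l n0) -[X in X * _](ger0_norm (ltW n0)) -normrM mulrBr ler_norml.
by apply/andP; split; lra.
Qed.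

Lemma sum_indic_trivIset_le (T : Type) (A : nat -> set T) n (y : T) :
  trivIset setT A -> \sum_(i < n) \1_(A i) y <= \1_(\bigcup_i A i) y :> R.
Proof.
move=> tA; have [[i0 Ay]|noA] := pselect (exists i : 'I_n, A i y).
  rewrite (bigD1 i0)//= big1 => [|i ii0].
    by rewrite addr0 !indicE !mem_set//; exists i0.
  rewrite indicE memNset// => Aiy; case/eqP: ii0; apply/val_inj.
  by apply: (tA (i : nat) (i0 : nat)) => //; exists y.
rewrite big1 => [|i _]; first by rewrite indicE ler0n.
by rewrite indicE memNset// => Aiy; apply: noA; exists i.
Qed.

(* Domination by a measure turns finite additivity into countable additivity. *)
Lemma positive_functional_measure F (eta : probability (Tor R d) R) (K : R) :
  bmeas_additive F -> bmeas_monotone F -> (forall c, F (fun=> c) = c) ->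
  (forall phi, bmeas phi -> (forall x, 0 <= phi x) -> F phi <= K * integ eta phi) ->
  exists mu : probability (Tor R d) R, forall phi, bmeas phi -> integ mu phi = F phi.
Proof.
move=> addF monF Fc Fdom.
(* The absolute value only matters for non-measurable A. *)
pose f (A : set (Tor R d)) : \bar R := `|F (perindic A)|%:E.
have fE A : measurable A -> f A = (F (perindic A))%:E.
  move=> mA; rewrite /f ger0_norm// -(Fc 0); apply: monF.
  - exact: bmeas_cst.
  - exact: bmeas_perindic.
  - by move=> x; rewrite /perindic indicE ler0n.
have f0 : f set0 = 0%E.
  rewrite /f (_ : perindic set0 = fun=> 0) ?Fc ?normr0//.
  by apply/funext => x; rewrite /perindic indicE in_set0.
have f_ge0 A : (0 <= f A)%E by rewrite lee_fin.
have f_sigma : semi_sigma_additive f.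
  move=> A mA tA mU; rewrite (fE _ mU).
  pose U : set (Tor R d) := \bigcup_i A i.
  (* The measure eta need not be carried by [0,1)^d: integrating [perindic (A i)] gives the eta-mass
     of the whole periodic set [B i], so countable additivity of eta is used on the [B i]. *)
  pose B i : set (Tor R d) := fract @^-1` (A i).
  have mpre (S : set (Tor R d)) : measurable S ->
      measurable (fract @^-1` S : set (Tor R d)).
    by move=> mS; have := measurable_fract measurableT _ mS; rewrite setTI.
  have tB : trivIset setT B.
    by move=> i j _ _ [x [Bi Bj]]; apply: tA => //; exists (fract x).
  have UB : \bigcup_i B i = fract @^-1` U by rewrite preimage_bigcup.
  have fin (S : set (Tor R d)) : measurable S ->
      eta (fract @^-1` S) = (integ eta (perindic S))%:E.
    by move=> mS; rewrite integ_perindic// fineK// fin_num_measure//; exact: mpre.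
  have := @measure_semi_sigma_additive _ _ _ eta B (fun i => mpre _ (mA i)) tB.
  rewrite UB => /(_ (mpre _ mU)); rewrite [X in _ --> X](fin U mU).
  rewrite (_ : (fun n => _) = 
      (fun n => (\sum_(i < n) integ eta (perindic (A i)))%:E)); last first.
    by apply/funext => n; rewrite big_mkord -sumEFin; apply: eq_bigr => i _; exact: fin.
  move=> /fine_cvgP[_ cveta].
  rewrite (_ : (fun n => _) = (fun n => (\sum_(i < n) F (perindic (A i)))%:E)); last first.
    by apply/funext => n; rewrite big_mkord -sumEFin; apply: eq_bigr => i _; rewrite fE.
  apply/fine_cvgP; split; first exact: nearW.
  have bU := bmeas_perindic _ mU.
  have bA i := bmeas_perindic _ (mA i).
  (* The remainder of the series for F is F of a nonnegative function, hence at most K times the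
     remainder for eta, which tends to 0. *)
  have bnd n : 0 <= F (perindic U) - \sum_(i < n) F (perindic (A i)) <=
      K * (integ eta (perindic U) - \sum_(i < n) integ eta (perindic (A i))).
    have bS := bmeas_sum n _ bA.
    have bg := bmeasB bU bS.
    have g0 x : 0 <= perindic U x - \sum_(i < n) perindic (A i) x.
      by rewrite subr_ge0; exact: sum_indic_trivIset_le.
    have split_at H : bmeas_additive H ->
        H (perindic U) - \sum_(i < n) H (perindic (A i)) =
        H (fun x => perindic U x - \sum_(i < n) perindic (A i) x).
      move=> addH; rewrite -(bmeas_additive_sum _ _ (fun i => perindic (A i)))//.
      apply/eqP; rewrite subr_eq -addH//; apply/eqP; congr (H _).
      by apply/funext => x; rewrite subrK.
    rewrite (split_at _ addF) (split_at (integ eta)); last first.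
      by move=> *; apply: integD => //; exact: probability_lty.
    rewrite Fdom// andbT -[leLHS](Fc 0); apply: monF => //.
    exact: bmeas_cst.
  apply/cvgrPdist_le => e e0.
  (* K has no prescribed sign and may vanish; [|K| + 1] is a safe divisor. *)
  have K1 : 0 < `|K| + 1 by rewrite ltr_wpDl.
  have e1 : 0 < e / (`|K| + 1) by rewrite divr_gt0.
  move/cvgrPdist_le : cveta => /(_ _ e1); apply: filterS => n /=.
  rewrite ler_pdivlMr// => hn; have /andP[b0 b1] := bnd n.
  rewrite ger0_norm//; apply: le_trans b1 _; apply: le_trans (ler_norm _) _.
  rewrite normrM mulrC; apply: le_trans hn.
  by rewrite ler_wpM2l// lerDl.
pose isM := isMeasure.Build _ _ _ f f0 f_ge0 f_sigma.
pose m : {measure set (Tor R d) -> \bar R} := HB.pack f isM.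
have mT : m setT = 1%E.
  rewrite /= fE// (_ : perindic setT = fun=> 1) ?Fc//.
  by apply/funext => x; rewrite /perindic indicT.
pose isP := Measure_isProbability.Build _ _ _ m mT.
pose P : probability (Tor R d) R := HB.pack f isM isP.
exists P => phi bphi; apply: eq_positive_functional => //.
- by move=> *; apply: integD => //; exact: probability_lty.
- by move=> *; apply: integ_le => //; exact: probability_lty.
- by move=> c; rewrite Fc integ_cst.
(* A set and its periodic extension have the same trace on [0,1)^d, hence the same [perindic] and
   the same mass under f. *)
- move=> A mA; rewrite integ_perindic//; transitivity (fine (f (fract @^-1` A))) => //.
  rewrite fE/=; last by have := measurable_fract measurableT _ mA; rewrite setTI.
  congr (F _); apply/funext => x.
  exact: (periodic_fract (perindic A) x (bmeas_perindic A mA).1).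
Qed.

End PositiveFunctionals.

(** * Powers of a strong Feller kernel and bounds on normalized powers *)

Section FellerTorusKernel.
Context {R : realType} {d : nat} {Q : R.-ftker Tor R d ~> Tor R d}.
Hypotheses (Qper : torus_kernel Q) (Qfeller : strong_feller Q).
Implicit Types (phi psi : V R d -> R) (mu : probability (Tor R d) R).

Lemma ftker_lty x : (Q x setT < +oo)%E.
Proof. by rewrite ltey_eq kernel_finite_transition. Qed.

(** Strong Feller gives continuity, hence measurability, and with periodicity also boundedness. This
    keeps all iterates in the class of test functions. *)
Lemma bmeas_Qop phi : bmeas phi -> bmeas (Qop Q phi).
Proof.
move=> bphi; split; first exact: Qper.
split; first by apply: continuous_measurable_Tor; exact: Qfeller.
by apply: periodic_continuous_bounded; [exact: Qper|exact: Qfeller].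
Qed.

Lemma bmeas_Qpow k phi : bmeas phi -> bmeas (Qpow Q k phi).
Proof. by move=> bphi; elim: k => // k IH; exact: bmeas_Qop. Qed.

Lemma QpowD k phi psi : bmeas phi -> bmeas psi ->
  Qpow Q k (fun x => phi x + psi x) = fun x => Qpow Q k phi x + Qpow Q k psi x.
Proof.
move=> bphi bpsi; elim: k => // k IH; rewrite /Qpow iterS -/(Qpow Q k _) IH.
by apply/funext => x; apply: integD; [exact: ftker_lty|exact: bmeas_Qpow..].
Qed.

Lemma QpowZ k c phi : bmeas phi ->
  Qpow Q k (fun x => c * phi x) = fun x => c * Qpow Q k phi x.
Proof.
move=> bphi; elim: k => // k IH; rewrite /Qpow iterS -/(Qpow Q k _) IH.
by apply/funext => x; apply: integZ; [exact: ftker_lty|exact: bmeas_Qpow].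
Qed.

Lemma le_Qpow k phi psi : bmeas phi -> bmeas psi ->
  (forall x, phi x <= psi x) -> forall x, Qpow Q k phi x <= Qpow Q k psi x.
Proof.
move=> bphi bpsi le; elim: k => // k IH x.
by apply: integ_le => //; [exact: ftker_lty|exact: bmeas_Qpow..].
Qed.

Lemma Qpow_addn k j phi : Qpow Q (k + j) phi = Qpow Q k (Qpow Q j phi).
Proof. exact: iterD. Qed.

(** Bounds on the ratio of Q^k phi to Q^k 1, written without division so that they are linear in phi
    and can be transported by a positive operator. *)
Definition normalized_ge k m phi :=
  forall x, m * Qpow Q k (fun=> 1) x <= Qpow Q k phi x.
Definition normalized_le k M phi :=
  forall x, Qpow Q k phi x <= M * Qpow Q k (fun=> 1) x.

Let b1 := @bmeas_cst R d 1.
Let bQ1 k := bmeas_Qpow k _ b1.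

Lemma normalized_ge_addn j {k m phi} : bmeas phi ->
  normalized_ge k m phi -> normalized_ge (j + k) m phi.
Proof.
move=> bphi h x; rewrite !Qpow_addn.
have -> : m * Qpow Q j (Qpow Q k (fun=> 1)) x =
    Qpow Q j (fun y => m * Qpow Q k (fun=> 1) y) x by rewrite QpowZ.
by apply: le_Qpow => //; [exact: bmeasZ|exact: bmeas_Qpow].
Qed.

Lemma normalized_le_addn j {k M phi} : bmeas phi ->
  normalized_le k M phi -> normalized_le (j + k) M phi.
Proof.
move=> bphi h x; rewrite !Qpow_addn.
have -> : M * Qpow Q j (Qpow Q k (fun=> 1)) x =
    Qpow Q j (fun y => M * Qpow Q k (fun=> 1) y) x by rewrite QpowZ.
by apply: le_Qpow => //; [exact: bmeas_Qpow|exact: bmeasZ].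
Qed.

Lemma normalized_geD k m n phi psi : bmeas phi -> bmeas psi ->
  normalized_ge k m phi -> normalized_ge k n psi ->
  normalized_ge k (m + n) (fun x => phi x + psi x).
Proof. by move=> ? ? h1 h2 x; rewrite QpowD// mulrDl lerD. Qed.

Lemma normalized_leD k m n phi psi : bmeas phi -> bmeas psi ->
  normalized_le k m phi -> normalized_le k n psi ->
  normalized_le k (m + n) (fun x => phi x + psi x).
Proof. by move=> ? ? h1 h2 x; rewrite QpowD// mulrDl lerD. Qed.

(** * Contraction of the normalized bounds, and the limit functional *)

Section Minorization.
Context {N : nat} {alpha : R} {eta : probability (Tor R d) R}.
Hypotheses (N_gt0 : (0 < N)%N) (alpha_itv : 0 < alpha < 1).
Hypothesis minor : forall phi, bmeas phi -> (forall x, 0 <= phi x) ->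
  forall x, alpha * integ eta phi <= Qpow Q N phi x /\
            Qpow Q N phi x <= alpha^-1 * integ eta phi.

(** The minorization of the function 1 gives Q^N 1 >= alpha; positivity lets this be iterated. *)
Lemma QpowM1_ge n x : alpha ^+ n <= Qpow Q (n * N) (fun=> 1) x.
Proof.
case/andP: alpha_itv => a0 a1.
elim: n x => [|n IH] x; first by rewrite expr0.
rewrite mulSn Qpow_addn.
have h : Qpow Q N (fun=> alpha ^+ n * 1) x <= Qpow Q N (Qpow Q (n * N) (fun=> 1)) x.
  by apply: le_Qpow => //; [exact: bmeas_cst|move=> y; rewrite mulr1].
apply: le_trans h; rewrite QpowZ// exprSr ler_wpM2l ?exprn_ge0 ?(ltW a0)//.
by have [+ _] := minor _ b1 (fun=> ler01) x; rewrite integ_cst mulr1.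
Qed.

(** The minorization only controls powers that are multiples of N. For other k, write Q^(kN) 1 = Q^k
    (Q^(kN-k) 1) <= (M + 1) Q^k 1, where M bounds Q^(kN-k) 1, and compare with alpha^k. *)
Lemma Qpow1_ge_gt0 k : exists2 c, 0 < c & forall x, c <= Qpow Q k (fun=> 1) x.
Proof.
case/andP: alpha_itv => a0 a1.
have [_ [_ [M hM]]] := bQ1 (k * N - k).
have M0 : 0 <= M by exact: le_trans (normr_ge0 _) (hM 0).
exists (alpha ^+ k / (M + 1)) => [|x]; first by rewrite divr_gt0 ?exprn_gt0//; lra.
rewrite ler_pdivrMr; last lra.
apply: le_trans (QpowM1_ge k x) _.
rewrite -(subnKC (leq_pmulr k N_gt0)) Qpow_addn mulrC.
have -> : (M + 1) * Qpow Q k (fun=> 1) x = Qpow Q k (fun=> (M + 1) * 1) x by rewrite QpowZ.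
apply: le_Qpow => //; first exact: bmeas_cst.
by move=> y; rewrite mulr1; have := hM y; rewrite ler_norml => /andP[_]; lra.
Qed.

Lemma integ_Qpow1_gt0 mu k : 0 < integ mu (Qpow Q k (fun=> 1)).
Proof.
have [c c0 hc] := Qpow1_ge_gt0 k; apply: lt_le_trans c0 _.
rewrite -[leLHS](integ_cst mu); apply: integ_le => //.
  exact: probability_lty.
exact: bmeas_cst.
Qed.

(** Both bounds are carried to the common power k + l, where Q^(k+l) 1 is positive and can be
    cancelled at a point. *)
Lemma normalized_ge_le k l m M phi : bmeas phi ->
  normalized_ge k m phi -> normalized_le l M phi -> m <= M.
Proof.
move=> bphi /(normalized_ge_addn l bphi) h1 /(normalized_le_addn k bphi) h2.
have [c c0 hc] := Qpow1_ge_gt0 (k + l).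
have := le_trans (h1 0); rewrite addnC => /(_ _ (h2 0)).
by rewrite ler_pM2r// (lt_le_trans c0).
Qed.

(* With h := Q^k 1 and u := Q^k phi - m h >= 0, both bounds of the minorization
   give Q^N u >= alpha^2 (eta u / eta h) Q^N h. *)
Lemma normalized_ge_step {k m phi} : bmeas phi -> normalized_ge k m phi ->
  normalized_ge (N + k)
    (m + alpha ^+ 2 * (integ eta (Qpow Q k phi) / integ eta (Qpow Q k (fun=> 1)) - m))
    phi.
Proof.
case/andP: alpha_itv => a0 a1 bphi h x; rewrite !Qpow_addn.
set q := Qpow Q k phi; set h1 := Qpow Q k (fun=> 1).
have bq : bmeas q by exact: bmeas_Qpow.
have bh1 : bmeas h1 by exact: bQ1.
have h1_ge0 y : 0 <= h1 y.
  by have [c c0 hc] := Qpow1_ge_gt0 k; exact: le_trans (ltW c0) (hc y).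
have eh : 0 < integ eta h1 by exact: integ_Qpow1_gt0.
have bu : bmeas (fun y => q y + - m * h1 y) by apply: bmeasD => //; exact: bmeasZ.
have u_ge0 y : 0 <= q y + - m * h1 y by have := h y; rewrite -/q -/h1; lra.
have [lo _] := minor _ bu u_ge0 x.
have [_ hi] := minor _ bh1 h1_ge0 x.
have bmh := bmeasZ (- m) bh1.
rewrite integD ?integZ// in lo; try exact: probability_lty.
rewrite QpowD ?QpowZ// in lo.
set e := integ eta h1 in eh lo hi *; set f := integ eta q in lo *.
set P := Qpow Q N h1 x in lo hi *.
(* Integrating u >= 0 against eta gives this sign, which is needed to multiply the upper bound on
   Q^N h. *)
have t0 : 0 <= f / e - m.
  rewrite subr_ge0 ler_pdivlMr//.
  have := @integ_le R d eta (fun=> 0) _ (probability_lty eta) (bmeas_cst 0) bu u_ge0.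
  rewrite integ_cst integD ?integZ//; try exact: probability_lty.
  by rewrite -/e -/f; lra.
have le1 : alpha ^+ 2 * (f / e - m) * P <= alpha * (f + - m * e).
  have -> : alpha * (f + - m * e) = alpha ^+ 2 * (f / e - m) * (alpha^-1 * e).
    by field; rewrite !gt_eqF.
  by rewrite ler_wpM2l// mulr_ge0// exprn_ge0// ltW.
rewrite mulrDl; lra.
Qed.

(** Upper bounds are lower bounds for -phi, so the contraction step is proved once; the form
    [-1 * phi] lets [QpowZ] and [integZ] apply. *)
Lemma normalized_leN k M phi : bmeas phi ->
  normalized_le k M phi <-> normalized_ge k (- M) (fun x => -1 * phi x).
Proof.
move=> bphi; split => h x; have := h x; rewrite QpowZ//; lra.
Qed.

Lemma normalized_le_step {k M phi} : bmeas phi -> normalized_le k M phi ->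
  normalized_le (N + k)
    (M - alpha ^+ 2 * (M - integ eta (Qpow Q k phi) / integ eta (Qpow Q k (fun=> 1))))
    phi.
Proof.
move=> bphi /(normalized_leN _ _ _ bphi) h; apply/normalized_leN => //.
have := normalized_ge_step (bmeasZ (-1) bphi) h.
rewrite QpowZ// integZ//; [|exact: probability_lty|exact: bmeas_Qpow].
by congr normalized_ge; ring.
Qed.

(** Starting from [-B, B] at power 0, each step moves both ends towards the same ratio t of
    eta-integrals by the fraction alpha^2 of their distance to t, so the width is multiplied by 1 -
    alpha^2 whatever t is. The remaining k mod N powers keep the interval. *)
Lemma normalized_contract k phi B : bmeas phi -> (forall x, `|phi x| <= B) ->
  exists m M, [/\ normalized_ge k m phi, normalized_le k M phi &
    M - m = 2 * B * (1 - alpha ^+ 2) ^+ (k %/ N)].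
Proof.
move=> bphi hB.
have key n : exists m M, [/\ normalized_ge (n * N) m phi,
    normalized_le (n * N) M phi & M - m = 2 * B * (1 - alpha ^+ 2) ^+ n].
  elim: n => [|n [m [M [h1 h2 e]]]].
    exists (- B), B; split; last by rewrite expr0; ring.
      by move=> x /=; have := hB x; rewrite ler_norml mulr1 => /andP[].
    by move=> x /=; have := hB x; rewrite ler_norml mulr1 => /andP[].
  rewrite mulSn; do 2 eexists; split.
  - exact: normalized_ge_step h1.
  - exact: normalized_le_step h2.
  - by rewrite (exprS _ n); move: (_ / _) => t; transitivity ((M - m) * (1 - alpha ^+ 2));
      [ring|rewrite e [RHS]mulrA mulrAC].
have [m [M [h1 h2 e]]] := key (k %/ N)%N.
exists m, M; split => //; rewrite {1}(divn_eq k N) addnC.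
  exact: normalized_ge_addn.
exact: normalized_le_addn.
Qed.

(* The common point of the intervals [m, M] with m Q^k 1 <= Q^k phi <= M Q^k 1. *)
Definition fk_limit phi : R := sup [set m | exists k, normalized_ge k m phi].

Lemma fk_limit_ge k m phi : bmeas phi -> normalized_ge k m phi -> m <= fk_limit phi.
Proof.
move=> bphi h; apply: ub_le_sup; last by exists k.
have [_ [_ [B hB]]] := bphi.
have [_ [M [_ hM _]]] := normalized_contract 0 _ _ bphi hB.
by exists M => m' [l h']; exact: normalized_ge_le h' hM.
Qed.

(** Every upper bound dominates every lower bound, at any powers; the bound at power 0 shows that
    the set under [sup] is nonempty. *)
Lemma fk_limit_le k M phi : bmeas phi -> normalized_le k M phi -> fk_limit phi <= M.
Proof.
move=> bphi h; apply: ge_sup; last by move=> m' [l h']; exact: normalized_ge_le h' h.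
have [_ [_ [B hB]]] := bphi.
by have [m [_ [hm _ _]]] := normalized_contract 0 _ _ bphi hB; exists m, 0%N.
Qed.

Lemma one_sub_sqr_itv : 0 < 1 - alpha ^+ 2 < 1.
Proof. by case/andP: alpha_itv => a0 a1; apply/andP; split; nra. Qed.

Lemma contract_cvg0 (e B : R) : 0 < e ->
  exists k, 2 * B * (1 - alpha ^+ 2) ^+ (k %/ N) < e.
Proof.
move=> e0; case/andP: one_sub_sqr_itv => r0 r1.
have h : `|1 - alpha ^+ 2| < 1 by rewrite ger0_norm ?ltW.
have : (2 * B * (1 - alpha ^+ 2) ^+ n) @[n --> \oo] --> 2 * B * 0.
  by apply: cvgM; [exact: cvg_cst|exact: cvg_expr].
rewrite mulr0 => /cvgr_lt/(_ _ e0)[n _ hn].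
exists (n * N)%N; rewrite mulnK//; exact: (hn n) (leqnn n).
Qed.

(** Holding for all large k, and not just one, it lets two functions be bracketed at the same
    power. *)
Lemma normalized_approx phi (e : R) : bmeas phi -> 0 < e ->
  exists k0, forall k, (k0 <= k)%N -> exists m M,
    [/\ normalized_ge k m phi, normalized_le k M phi & M - m < e].
Proof.
move=> bphi e0; have [_ [_ [B hB]]] := bphi.
have [k0 hk0] := contract_cvg0 e B e0; exists k0 => k k0k.
have [m [M [h1 h2 e1]]] := normalized_contract k0 _ _ bphi hB.
exists m, M; split; last by rewrite e1.
  by rewrite -(subnK k0k); exact: normalized_ge_addn.
by rewrite -(subnK k0k); exact: normalized_le_addn.
Qed.

Lemma fk_limit_unique phi (l : R) : bmeas phi ->
  (forall e, 0 < e -> exists k m M,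
    [/\ normalized_ge k m phi, normalized_le k M phi &
        m - e <= l <= M + e /\ M - m < e]) ->
  fk_limit phi = l.
Proof.
move=> bphi h; apply/eqP; rewrite -subr_eq0 -normr_le0; apply/ler_addgt0Pl => e e0.
have e3 : 0 < e / 3 by lra.
have [k [m [M [h1 h2 [/andP[h3 h4] h5]]]]] := h _ e3.
have := fk_limit_ge _ _ _ bphi h1; have := fk_limit_le _ _ _ bphi h2 => h6 h7.
by rewrite addr0 ler_norml; apply/andP; split; lra.
Qed.

Lemma fk_limitD phi psi : bmeas phi -> bmeas psi ->
  fk_limit (fun x => phi x + psi x) = fk_limit phi + fk_limit psi.
Proof.
move=> bphi bpsi; apply: fk_limit_unique; first exact: bmeasD.
move=> e e0; have e2 : 0 < e / 2 by lra.
have [k1 hk1] := normalized_approx _ _ bphi e2.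
have [k2 hk2] := normalized_approx _ _ bpsi e2.
have [m [M [h1 h2 h3]]] := hk1 _ (leq_maxl k1 k2).
have [m' [M' [h1' h2' h3']]] := hk2 _ (leq_maxr k1 k2).
exists (maxn k1 k2), (m + m'), (M + M'); split.
- exact: normalized_geD.
- exact: normalized_leD.
- have := fk_limit_ge _ _ _ bphi h1; have := fk_limit_le _ _ _ bphi h2.
  have := fk_limit_ge _ _ _ bpsi h1'; have := fk_limit_le _ _ _ bpsi h2'.
  by move=> *; split; [apply/andP; split; lra|lra].
Qed.

Lemma fk_limit_mono phi psi : bmeas phi -> bmeas psi ->
  (forall x, phi x <= psi x) -> fk_limit phi <= fk_limit psi.
Proof.
move=> bphi bpsi le; apply/ler_addgt0Pr => e e0.
have [k hk] := normalized_approx _ _ bphi e0.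
have [m [M [h1 h2 h3]]] := hk _ (leqnn k).
have h1' : normalized_ge k m psi.
  by move=> x; apply: le_trans (h1 x) _; exact: le_Qpow.
by have := fk_limit_ge _ _ _ bpsi h1'; have := fk_limit_le _ _ _ bphi h2; lra.
Qed.

Lemma fk_limit_cst c : fk_limit (fun=> c) = c.
Proof.
have e k x : Qpow Q k (fun=> c) x = c * Qpow Q k (fun=> 1) x.
  by rewrite -[in LHS](mulr1 c) QpowZ.
apply/eqP; rewrite eq_le; apply/andP; split.
  by apply: (@fk_limit_le 0); [exact: bmeas_cst|move=> x; rewrite e].
by apply: (@fk_limit_ge 0); [exact: bmeas_cst|move=> x; rewrite e].
Qed.

(** At power N, Q^N phi <= alpha^-1 eta(phi) and Q^N 1 >= alpha. This is the domination that yields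
    countable additivity of the limit. *)
Lemma fk_limit_le_eta phi : bmeas phi -> (forall x, 0 <= phi x) ->
  fk_limit phi <= alpha^-1 ^+ 2 * integ eta phi.
Proof.
case/andP: alpha_itv => a0 a1 bphi phi0; apply: (@fk_limit_le N) => // x.
have [_ hi] := minor _ bphi phi0 x; apply: le_trans hi _.
have [lo _] := minor _ b1 (fun=> ler01) x; rewrite integ_cst mulr1 in lo.
have eta0 : 0 <= integ eta phi.
  rewrite -(integ_cst eta 0); apply: integ_le => //; last exact: bmeas_cst.
  exact: probability_lty.
have -> : alpha^-1 * integ eta phi = alpha^-1 ^+ 2 * integ eta phi * alpha.
  by field; rewrite gt_eqF.
by rewrite ler_wpM2l// mulr_ge0// exprn_ge0// invr_ge0 ltW.
Qed.

(** * Convergence of the normalized dynamics; existence and uniqueness of the invariant measure *)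

Lemma Phi_normalized mu k m M phi : bmeas phi ->
  normalized_ge k m phi -> normalized_le k M phi -> m <= Phi Q k mu phi <= M.
Proof.
move=> bphi h1 h2; have i0 := integ_Qpow1_gt0 mu k.
have bk := bmeas_Qpow k _ bphi.
rewrite /Phi ler_pdivlMr// ler_pdivrMr//; apply/andP; split.
  rewrite -integZ//; last exact: probability_lty.
  by apply: integ_le => //; [exact: probability_lty|exact: bmeasZ].
rewrite -integZ//; last exact: probability_lty.
by apply: integ_le => //; [exact: probability_lty|exact: bmeasZ].
Qed.

Lemma Phi_cvg_fk_limit mu k phi : bmeas phi ->
  `|Phi Q k mu phi - fk_limit phi| <=
    2 * supnorm phi * (1 - alpha ^+ 2) ^+ (k %/ N).
Proof.
move=> bphi.
have [m [M [h1 h2 <-]]] :=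
  normalized_contract k _ _ bphi (fun x => bmeas_le_supnorm _ x bphi).
have /andP[h3 h4] := Phi_normalized mu _ _ _ _ bphi h1 h2.
have := fk_limit_ge _ _ _ bphi h1; have := fk_limit_le _ _ _ bphi h2.
by move=> *; rewrite ler_norml; apply/andP; split; lra.
Qed.

(** For invariance, bracket phi by m and M at power k + 1. Then Q^k (Q phi - m Q 1) >= 0, so the
    limit functional, which is integration against mu, is nonnegative on Q phi - m Q 1. This says m
    <= Phi_1(mu)(phi); M is symmetric, and M - m is arbitrarily small. *)
Lemma fk_invariant_exists : exists2 mustar : probability (Tor R d) R,
  fk_invariant Q mustar & forall phi, bmeas phi -> integ mustar phi = fk_limit phi.
Proof.
have [mu hmu] := positive_functional_measure _ _ _
  fk_limitD fk_limit_mono fk_limit_cst fk_limit_le_eta.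
exists mu => // phi bphi.
have mu_lty := probability_lty mu.
have i0 := integ_Qpow1_gt0 mu 1.
have bq := bmeas_Qpow 1 _ bphi; have bh := bQ1 1.
apply/eqP; rewrite -subr_eq0 -normr_le0; apply/ler_addgt0Pl => e e0; rewrite addr0.
have [k hk] := normalized_approx _ _ bphi e0.
have [m [M [h1 h2 hmM]]] := hk _ (leqnSn k).
have := fk_limit_ge _ _ _ bphi h1; have := fk_limit_le _ _ _ bphi h2.
rewrite -hmu// => Mge mle.
have combE c : bmeas (fun x => Qpow Q 1 phi x + c * Qpow Q 1 (fun=> 1) x) /\
    forall x, Qpow Q k (fun x => Qpow Q 1 phi x + c * Qpow Q 1 (fun=> 1) x) x =
      Qpow Q k.+1 phi x + c * Qpow Q k.+1 (fun=> 1) x.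
  have bch := bmeasZ c bh.
  by split=> [|x]; [exact: bmeasD|rewrite QpowD ?QpowZ// -!Qpow_addn addn1].
have integE c : integ mu (fun x => Qpow Q 1 phi x + c * Qpow Q 1 (fun=> 1) x) =
    integ mu (Qpow Q 1 phi) + c * integ mu (Qpow Q 1 (fun=> 1)).
  have bch := bmeasZ c bh.
  by rewrite integD ?integZ.
have lo : m <= Phi Q 1 mu phi.
  have [bc cE] := combE (- m).
  rewrite /Phi ler_pdivlMr// -subr_ge0 -mulNr -integE hmu//.
  apply: (@fk_limit_ge k) => // x; rewrite cE mul0r.
  by have := h1 x; lra.
have hi : Phi Q 1 mu phi <= M.
  have [bc cE] := combE (- M).
  rewrite /Phi ler_pdivrMr// -subr_le0 -mulNr -integE hmu//.
  apply: (@fk_limit_le k) => // x; rewrite cE mul0r.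
  by have := h2 x; lra.
by rewrite ler_norml; apply/andP; split; lra.
Qed.

(** A fixed point of Phi_1 is a left eigenvector of Q with eigenvalue l = nu(Q 1) > 0, and the
    factor l^k cancels in the quotient. *)
Lemma Phi_invariant nu k phi : fk_invariant Q nu -> bmeas phi ->
  Phi Q k nu phi = integ nu phi.
Proof.
move=> inv bphi; set l := integ nu (Qpow Q 1 (fun=> 1)).
have l0 : 0 < l by exact: integ_Qpow1_gt0.
have step psi : bmeas psi -> integ nu (Qpow Q 1 psi) = l * integ nu psi.
  by move=> bpsi; rewrite -(inv _ bpsi) /Phi -/l; field; rewrite gt_eqF.
have pow psi : bmeas psi -> integ nu (Qpow Q k psi) = l ^+ k * integ nu psi.
  move=> bpsi; elim: k => [|j IH]; first by rewrite mul1r.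
  by rewrite -(add1n j) Qpow_addn step ?IH ?exprS ?mulrA//; exact: bmeas_Qpow.
by rewrite /Phi !pow// integ_cst mulr1 mulrC mulKf// expf_neq0// gt_eqF.
Qed.

(** Phi_k(nu) is constant in k by invariance, yet converges to the limit functional. *)
Lemma fk_invariant_integ nu phi : fk_invariant Q nu -> bmeas phi ->
  integ nu phi = fk_limit phi.
Proof.
move=> inv bphi; apply/eqP; rewrite -subr_eq0 -normr_le0.
apply/ler_addgt0Pl => e e0; rewrite addr0.
have [k hk] := contract_cvg0 e (supnorm phi) e0.
rewrite -(Phi_invariant _ k _ inv bphi).
exact: le_trans (Phi_cvg_fk_limit _ _ _ bphi) (ltW hk).
Qed.

End Minorization.
End FellerTorusKernel.

(** * Exponential rate uniform in the time step *)

Lemma expn_divn_le_expR {R : realType} (r T dts dt : R) (k : nat) :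
  0 < r < 1 -> 0 < T -> 0 < dt <= dts ->
  r ^+ (k %/ `|Num.ceil (T / dt)|) <=
    r^-1 * expR (- (- ln r / (T + dts) * k%:R * dt)).
Proof.
move=> /andP[r0 r1] T0 /andP[dt0 dtle].
have ceil_gt0 : (0 < Num.ceil (T / dt))%R by rewrite ceil_gt0 divr_gt0.
set N := `|Num.ceil (T / dt)|%N; set n := (k %/ N)%N.
have N0 : (0 < N)%N by rewrite absz_gt0 gt_eqF.
(* The ceiling exceeds T / dt by less than 1, so N dt < T + dt. *)
have NdtE : N%:R * dt <= T + dts.
  have NR : N%:R = (Num.ceil (T / dt))%:~R :> R.
    by rewrite /N natr_absz ger0_norm// ltW.
  have NT : N%:R - 1 < T / dt.
    by rewrite NR; have /andP[+ _] := ceil_itv (T / dt); rewrite intrB.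
  by rewrite ltr_pdivlMr// in NT; lra.
(* Hence k dt <= (n + 1)(T + dts); the extra 1 from rounding k / N down is paid for by the factor
   r^-1. *)
have kle : k%:R <= (n%:R + 1) * N%:R :> R.
  by rewrite natr1 -natrM ler_nat ltnW// ltn_ceil.
have g0 : 0 < - ln r by rewrite oppr_gt0 ln_lt0// r0.
have -> : r ^+ n = expR (n%:R * ln r) by rewrite expRM_natl lnK// posrE.
have -> : r^-1 = expR (- ln r) by rewrite expRN lnK// posrE.
rewrite -expRD ler_expR.
have S0 : 0 < T + dts by lra.
suff : (- ln r) * (k%:R * dt / (T + dts)) <= (- ln r) * (n%:R + 1) by lra.
rewrite ler_wpM2l ?(ltW g0)// ler_pdivrMr//.
apply: le_trans (ler_wpM2r (ltW dt0) kle) _.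
by rewrite -mulrA ler_wpM2l// addr_ge0.
Qed.

Theorem theorem4 (R : realType) (d : nat) (b : V R d -> V R d) (f : V R d -> R)
  (Q : R -> R.-ftker Tor R d ~> Tor R d) (T : R) :
  (forall i : 'I_d, smooth_torus (fun x => b x 0 i)) ->
  smooth_torus f ->
  (forall dt, 0 < dt -> torus_kernel (Q dt)) ->
  consistent b f Q ->
  0 < T -> assumption6 T Q ->
  exists dtss : R, 0 < dtss /\
  exists kappa C : R, 0 < kappa /\ 0 < C /\
  forall dt, 0 < dt -> dt <= dtss ->
  exists mustar : probability (Tor R d) R,
    fk_invariant (Q dt) mustar /\
    (forall nu : probability (Tor R d) R, fk_invariant (Q dt) nu ->
       forall phi, bmeas phi -> integ nu phi = integ mustar phi) /\
    (forall phi, bmeas phi -> forall (mu : probability (Tor R d) R) (k : nat),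
       `| Phi (Q dt) k mu phi - integ mustar phi |
         <= C * expR (- (kappa * k%:R * dt)) * supnorm phi).
Proof.
move=> _ _ Qper _ T0 [dts [eta [alpha [dts0 [alpha_itv hA]]]]].
have ritv : 0 < 1 - alpha ^+ 2 < 1 by exact: one_sub_sqr_itv.
have /andP[r0 r1] := ritv.
set r := 1 - alpha ^+ 2 in ritv r0 r1.
(* In the constant 2 / r, the 2 is the width of the initial interval relative to the sup norm, and 1
   / r absorbs the rounding of k / N. *)
exists dts; split => //; exists (- ln r / (T + dts)), (2 / r); split.
  by rewrite divr_gt0 ?addr_gt0// oppr_gt0 ln_lt0// r0.
split=> [|dt dt0 dtle]; first by rewrite divr_gt0.
have [Qfeller minor] := hA _ dt0 dtle.
have N0 : (0 < `|Num.ceil (T / dt)|)%N.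
  by rewrite absz_gt0 gt_eqF// ceil_gt0 divr_gt0.
have [mu inv muE] := fk_invariant_exists (Qper _ dt0) Qfeller N0 alpha_itv minor.
exists mu; split => //; split=> [nu nuinv phi bphi|phi bphi nu k].
  rewrite muE//.
  exact: (fk_invariant_integ (Qper _ dt0) Qfeller N0 alpha_itv minor).
rewrite muE//.
apply: le_trans
  (Phi_cvg_fk_limit (Qper _ dt0) Qfeller N0 alpha_itv minor nu k phi bphi) _.
have s0 : 0 <= supnorm phi.
  exact: le_trans (normr_ge0 _) (bmeas_le_supnorm phi 0 bphi).
have dti : 0 < dt <= dts by rewrite dt0.
have := expn_divn_le_expR r T dts dt k ritv T0 dti.
set E := expR _ => h.
have -> : 2 / r * E * supnorm phi = 2 * supnorm phi * (r^-1 * E).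
  by ring.
by rewrite ler_wpM2l// mulr_ge0.
Qed.
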